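(* Let $X$ be a path-connected topological space, let $x_0\in X$ and let $X_1$ and $X_2$ be subspaces of $X$ such that their interiors cover $X$ and such that for $j\in\{1,2\}$ the inclusion of each path-connected component of $X_j$ in $X$ induces the trivial morphism between the fundamental groups. Then $\pi_1(X,x_0)$ is a free group. *)

(* Defs.v *)
From HB Require Import structures.
From mathcomp Require Import all_boot all_order all_algebra.
From mathcomp Require Import generic_quotient monoid.
From mathcomp Require Import all_classical all_reals all_analysis.
From mathcomp Require Import homotopy.
From mathcomp Require Import lra.

Set Implicit Arguments.
Unset Strict Implicit.
Unset Printing Implicit Defensive.

Import Order.TTheory GRing.Theory Num.Theory.
Import numFieldNormedType.Exports.

Local Open Scope classical_set_scope.
Local Open Scope ring_scope.
Local Open Scope quotient_scope.

Lemma continuous_subtype (T X : topologicalType) (A : set X) (f : T -> A) :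
  continuous (fun t => val (f t)) -> continuous f.
Proof. by move=> cf; apply: continuous_comp_initial. Qed.

Lemma continuous_if_le (R : realType) (T U : topologicalType) (h k : T -> R)
    (f g : T -> U) :
  continuous h -> continuous k -> continuous f -> continuous g ->
  (forall t, h t = k t -> f t = g t) ->
  continuous (fun t => if h t <= k t then f t else g t).
Proof.
move=> ch ck cf cg fg t U0 /= Ut.
have chk : (h \- k) @ t --> h t - k t by apply: cvgB; [exact: ch|exact: ck].
change (\forall s \near t, U0 (if h s <= k s then f s else g s)).
case: (ltgtP (h t) (k t)) Ut => hk Ut.
- have ft : \forall s \near t, U0 (f s) by exact: cf.
  have : \forall s \near t, h s - k s < 0.
    by apply: (cvgr_lt _ chk); rewrite subr_lt0.
  by apply: filterS2 ft => s fs; rewrite subr_lt0 => /ltW ->.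
- have gt : \forall s \near t, U0 (g s) by exact: cg.
  have : \forall s \near t, 0 < h s - k s.
    by apply: (cvgr_gt _ chk); rewrite subr_gt0.
  by apply: filterS2 gt => s gs; rewrite subr_gt0 leNgt => ->.
- have gt : \forall s \near t, U0 (g s) by apply: cg; rewrite -(fg _ hk).
  have ft : \forall s \near t, U0 (f s) by exact: cf.
  by apply: filterS2 gt ft => s gs fs; case: ifP.
Qed.

Definition unit_interval (R : realType) : Type := `[0%R, 1%R]%classic : set R.

HB.instance Definition _ (R : realType) :=
  SubType.copy (unit_interval R) (`[0%R, 1%R]%classic : set R).
HB.instance Definition _ (R : realType) :=
  Topological.copy (unit_interval R) (`[0%R, 1%R]%classic : set R).

Definition coord (R : realType) (t : unit_interval R) : R := val t.
Arguments coord : simpl never.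

Lemma clamp_subproof (R : realType) (x : R) :
  Num.max 0 (Num.min 1 x) \in (`[0%R, 1%R]%classic : set R).
Proof.
by rewrite inE /= in_itv /= le_max lexx ge_max ler01 ge_min lexx.
Qed.

(* The retraction of the real line onto the unit interval. *)
Definition clamp (R : realType) (x : R) : unit_interval R :=
  @exist _ (fun y => y \in (`[0%R, 1%R]%classic : set R)) _ (clamp_subproof x).
Arguments clamp : simpl never.

Section unit_interval.
Context {R : realType}.
Local Notation I := (unit_interval R).

Lemma coord_clamp (x : R) : coord (clamp x) = Num.max 0 (Num.min 1 x).
Proof. by []. Qed.

Lemma coord_inj : injective (@coord R).
Proof. by move=> s t /val_inj. Qed.

Lemma clampE (x : R) : 0 <= x <= 1 -> coord (clamp x) = x.
Proof. by case/andP=> x0 x1; rewrite coord_clamp min_r// max_r. Qed.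

Lemma coord_bound (t : I) : 0 <= coord t <= 1.
Proof. by case: t => t; rewrite /coord /= inE /= in_itv. Qed.

Lemma clampK (t : I) : clamp (coord t) = t.
Proof. by apply: coord_inj; rewrite clampE // coord_bound. Qed.

Lemma zero_one_subproof : clamp 0 != clamp 1 :> I.
Proof.
apply/eqP => /(congr1 (@coord R)); rewrite !clampE ?lexx ?ler01 //.
by apply/eqP; rewrite eq_sym oner_neq0.
Qed.

HB.instance Definition _ := isBiPointed.Build I zero_one_subproof.

Lemma clamp0 : clamp 0 = zero :> I. Proof. by []. Qed.

Lemma clamp1 : clamp 1 = one :> I. Proof. by []. Qed.

Lemma coord0 : coord (zero : I) = 0.
Proof. by rewrite -clamp0 clampE // lexx ler01. Qed.

Lemma coord1 : coord (one : I) = 1.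
Proof. by rewrite -clamp1 clampE // lexx ler01. Qed.

Lemma continuous_coord : continuous (@coord R).
Proof. exact: initial_continuous. Qed.

Lemma continuous_clamp : continuous (@clamp R).
Proof.
apply: continuous_subtype => x; apply: continuous_max; first exact: cvg_cst.
by apply: continuous_min; [exact: cvg_cst|exact: cvg_id].
Qed.

End unit_interval.

Definition incl (X : topologicalType) (A : set X) : A -> X := val.

Lemma continuous_incl (X : topologicalType) (A : set X) : continuous (@incl X A).
Proof. exact: initial_continuous. Qed.

HB.instance Definition _ (X : topologicalType) (A : set X) :=
  isContinuous.Build A X (@incl X A) (@continuous_incl X A).

Section path_homotopy.
Context {R : realType} {X : topologicalType}.
Local Notation I := (unit_interval R).

(* Homotopy relative to the endpoints. *)
Definition path_homotopic (p q : I -> X) : Prop :=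
  exists H : I * I -> X,
    [/\ continuous H,
        forall s, H (s, zero) = p s,
        forall s, H (s, one) = q s,
        forall t, H (zero, t) = p zero &
        forall t, H (one, t) = p one].

Definition concat (p q : I -> X) (t : I) : X :=
  if coord t <= 2^-1 then p (clamp (2 * coord t)) else q (clamp (2 * coord t - 1)).

Definition reverse (p : I -> X) (t : I) : X := p (clamp (1 - coord t)).

Lemma concat0 p q : concat p q zero = p zero.
Proof.
by rewrite /concat coord0 invr_ge0 ler0n mulr0 -[in RHS](clampK zero) coord0.
Qed.

Lemma concat1 p q : concat p q one = q one.
Proof.
rewrite /concat coord1 ifF; last by apply/negbTE; rewrite -ltNge; lra.
by rewrite (_ : 2 * 1 - 1 = 1 :> R) -?coord1 ?clampK // coord1; lra.
Qed.

Lemma reverse0 p : reverse p zero = p one.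
Proof. by rewrite /reverse coord0 subr0 -(clampK one) coord1. Qed.

Lemma reverse1 p : reverse p one = p zero.
Proof. by rewrite /reverse coord1 subrr -(clampK zero) coord0. Qed.

Lemma continuous_affine (T : topologicalType) (h : T -> R) (a b : R) :
  continuous h -> continuous (fun t => a * h t + b).
Proof.
move=> ch t; apply: cvgD; last exact: cvg_cst.
by apply: cvgM; [exact: cvg_cst|exact: ch].
Qed.

Lemma continuous_clamp_affine (T : topologicalType) (h : T -> R) (a b : R) :
  continuous h -> continuous (fun t => clamp (a * h t + b)).
Proof.
move=> ch t; apply: (@continuous_comp _ _ _ (fun t => a * h t + b)).
  exact: continuous_affine.
exact: continuous_clamp.
Qed.

Lemma continuous_compfun (T U V : topologicalType) (f : T -> U) (g : U -> V) :
  continuous f -> continuous g -> continuous (fun t => g (f t)).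
Proof. by move=> cf cg t; apply: continuous_comp; [exact: cf|exact: cg]. Qed.

Lemma continuous_pair (T U V : topologicalType) (f : T -> U) (g : T -> V) :
  continuous f -> continuous g -> continuous (fun t => (f t, g t)).
Proof. by move=> cf cg t; apply: cvg_pair; [exact: cf|exact: cg]. Qed.

Lemma continuous_coord_fst : continuous (fun st : I * I => coord st.1 : R).
Proof.
by apply: continuous_compfun continuous_coord => t; exact: cvg_fst.
Qed.

Lemma continuous_coord_snd : continuous (fun st : I * I => coord st.2 : R).
Proof.
by apply: continuous_compfun continuous_coord => t; exact: cvg_snd.
Qed.

Lemma continuous_concat p q : continuous p -> continuous q ->
  p one = q zero -> continuous (concat p q).
Proof.
move=> cp cq pq; apply: continuous_if_le.
- exact: continuous_coord.
- exact: cst_continuous.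
- apply: continuous_compfun cp.
  under eq_fun do rewrite -[_ * _]addr0.
  exact/continuous_clamp_affine/continuous_coord.
- by apply: continuous_compfun cq; exact/continuous_clamp_affine/continuous_coord.
- move=> t ->; rewrite mulfV ?pnatr_eq0// subrr.
  by rewrite -[in LHS]coord1 -[in RHS]coord0 !clampK.
Qed.

Lemma continuous_reverse p : continuous p -> continuous (reverse p).
Proof.
move=> cp; apply: continuous_compfun cp.
under eq_fun do rewrite addrC -mulN1r.
exact/continuous_clamp_affine/continuous_coord.
Qed.

Lemma path_homotopic_refl p : continuous p -> path_homotopic p p.
Proof.
move=> cp; exists (fun st => p st.1); split=> //.
by apply: continuous_compfun cp => t; exact: cvg_fst.
Qed.

Lemma path_homotopic_end p q : path_homotopic p q ->
  p zero = q zero /\ p one = q one.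
Proof. by case=> H [_ _ Hq H0 H1]; rewrite -(H0 one) -(H1 one) !Hq. Qed.

Lemma path_homotopic_sym p q : path_homotopic p q -> path_homotopic q p.
Proof.
move=> pq; have [p0 p1] := path_homotopic_end pq.
case: pq => H [cH Hp Hq H0 H1].
exists (fun st => H (st.1, clamp (1 - coord st.2))); split=> [|s|s|t|t] /=.
- apply: continuous_compfun cH; apply: continuous_pair.
    by move=> t; exact: cvg_fst.
  under eq_fun do rewrite addrC -mulN1r.
  exact/continuous_clamp_affine/continuous_coord_snd.
- by rewrite coord0 subr0 -Hq -[in RHS](clampK one) coord1.
- by rewrite coord1 subrr -Hp -[in RHS](clampK zero) coord0.
- by rewrite H0 p0.
- by rewrite H1 p1.
Qed.

Lemma path_homotopic_trans p q r :
  path_homotopic p q -> path_homotopic q r -> path_homotopic p r.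
Proof.
move=> pq; have [p0 p1] := path_homotopic_end pq.
case: pq => H [cH Hp Hq H0 H1] [K [cK Kq Kr K0 K1]].
exists (fun st => if coord st.2 <= 2^-1 then H (st.1, clamp (2 * coord st.2))
                  else K (st.1, clamp (2 * coord st.2 - 1))); split=> [|s|s|t|t] /=.
- apply: continuous_if_le.
  + exact: continuous_coord_snd.
  + exact: cst_continuous.
  + apply: continuous_compfun cH; apply: continuous_pair.
      by move=> t; exact: cvg_fst.
    under eq_fun do rewrite -[_ * _]addr0.
    exact/continuous_clamp_affine/continuous_coord_snd.
  + apply: continuous_compfun cK; apply: continuous_pair.
      by move=> t; exact: cvg_fst.
    exact/continuous_clamp_affine/continuous_coord_snd.
  + move=> t ->; rewrite mulfV ?pnatr_eq0// subrr.
    by rewrite -[in LHS]coord1 -[in RHS]coord0 !clampK Hq Kq.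
- by rewrite coord0 invr_ge0 ler0n mulr0 -Hp -[in RHS](clampK zero) coord0.
- rewrite coord1 ifF; last by apply/negbTE; rewrite -ltNge; lra.
  by rewrite (_ : 2 * 1 - 1 = 1 :> R) -?coord1 ?clampK // coord1; lra.
- by rewrite H0 K0 p0 if_same.
- by rewrite H1 K1 p1 if_same.
Qed.

Lemma path_homotopic_concat p p' q q' : p one = q zero ->
  path_homotopic p p' -> path_homotopic q q' ->
  path_homotopic (concat p q) (concat p' q').
Proof.
move=> pq [H [cH Hp Hp' H0 H1]] [K [cK Kq Kq' K0 K1]].
exists (fun st => concat (fun s => H (s, st.2)) (fun s => K (s, st.2)) st.1).
split=> [|s|s|t|t] /=.
- apply: continuous_if_le.
  + exact: continuous_coord_fst.
  + exact: cst_continuous.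
  + apply: continuous_compfun cH; apply: continuous_pair; last first.
      by move=> t; exact: cvg_snd.
    under eq_fun do rewrite -[_ * _]addr0.
    exact/continuous_clamp_affine/continuous_coord_fst.
  + apply: continuous_compfun cK; apply: continuous_pair; last first.
      by move=> t; exact: cvg_snd.
    exact/continuous_clamp_affine/continuous_coord_fst.
  + move=> t ->; rewrite mulfV ?pnatr_eq0// subrr.
    by rewrite -[in LHS]coord1 -[in RHS]coord0 !clampK H1 K0.
- by rewrite /concat Hp Kq.
- by rewrite /concat Hp' Kq'.
- by rewrite !concat0 H0.
- by rewrite !concat1 K1.
Qed.

Lemma path_homotopic_reverse p q :
  path_homotopic p q -> path_homotopic (reverse p) (reverse q).
Proof.
case=> H [cH Hp Hq H0 H1].
exists (fun st => reverse (fun s => H (s, st.2)) st.1); split=> [|s|s|t|t] /=.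
- apply: continuous_compfun cH; apply: continuous_pair; last first.
    by move=> t; exact: cvg_snd.
  under eq_fun do rewrite addrC -mulN1r.
  exact/continuous_clamp_affine/continuous_coord_fst.
- by rewrite /reverse Hp.
- by rewrite /reverse Hq.
- by rewrite !reverse0 H1.
- by rewrite !reverse1 H0.
Qed.

(* The straight-line homotopy in the unit interval. *)
Lemma path_homotopic_reparam (p : I -> X) (a b : I -> I) : continuous p ->
  continuous a -> continuous b -> a zero = b zero -> a one = b one ->
  path_homotopic (fun t => p (a t)) (fun t => p (b t)).
Proof.
move=> cp ca cb ab0 ab1.
exists (fun st => p (clamp (coord (a st.1) + coord st.2 * (coord (b st.1) - coord (a st.1))))).
have cva (c : I -> I) : continuous c -> continuous (fun st : I * I => coord (c st.1) : R).
  move=> cc; apply: continuous_compfun continuous_coord.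
  by apply: continuous_compfun cc => t; exact: cvg_fst.
split=> [|s|s|t|t] /=.
- apply: continuous_compfun cp; apply: continuous_compfun continuous_clamp => t.
  apply: cvgD; first exact: cva.
  apply: cvgM; first exact: continuous_coord_snd.
  by apply: cvgB; exact: cva.
- by rewrite coord0 mul0r addr0 clampK.
- by rewrite coord1 mul1r addrC subrK clampK.
- by rewrite ab0 subrr mulr0 addr0 clampK.
- by rewrite ab1 subrr mulr0 addr0 clampK.
Qed.

Lemma path_homotopic_concat1p p : continuous p ->
  path_homotopic (concat (cst (p zero)) p) p.
Proof.
move=> cp; have -> : concat (cst (p zero)) p =
    fun t => p (clamp (2 * coord t - 1)).
  apply/funext => t; rewrite /concat; case: ifPn => // t2.
  rewrite /cst; congr p; apply: coord_inj; rewrite coord0 coord_clamp.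
  by rewrite max_l// ge_min; apply/orP; right; lra.
apply: (@path_homotopic_reparam p (fun t => clamp (2 * coord t - 1)) id) => //.
- exact/continuous_clamp_affine/continuous_coord.
- by move=> t; exact: cvg_id.
- by apply: coord_inj; rewrite coord0 coord_clamp max_l// ge_min.
- by rewrite coord1 -[RHS]clampK coord1; congr clamp; lra.
Qed.

Lemma path_homotopic_concatp1 p : continuous p ->
  path_homotopic (concat p (cst (p one))) p.
Proof.
move=> cp; have -> : concat p (cst (p one)) = fun t => p (clamp (2 * coord t)).
  apply/funext => t; rewrite /concat; case: ifPn => // t2.
  rewrite /cst; congr p; apply: coord_inj; rewrite coord1 coord_clamp.
  have : 1 <= 2 * coord t by move: t2; rewrite -ltNge; lra.
  by move=> ?; rewrite min_l// max_r.
apply: (@path_homotopic_reparam p (fun t => clamp (2 * coord t)) id) => //.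
- under eq_fun do rewrite -[_ * _]addr0.
  exact/continuous_clamp_affine/continuous_coord.
- by move=> t; exact: cvg_id.
- by rewrite coord0 mulr0 -[RHS]clampK coord0.
- apply: coord_inj; rewrite coord1 coord_clamp mulr1 min_l ?max_r//.
  by lra.
Qed.

Lemma continuous_dist_half :
  continuous (fun t : I => `|2 * coord t - 1| : R).
Proof.
apply: (@continuous_compfun I R R (fun t => 2 * coord t - 1) Num.norm).
  exact: (@continuous_affine I (@coord R) 2 (- 1) continuous_coord).
exact: norm_continuous.
Qed.

Lemma path_homotopic_concatVp p : continuous p ->
  path_homotopic (concat (reverse p) p) (cst (p one)).
Proof.
move=> cp; have -> : concat (reverse p) p = fun t => p (clamp `|2 * coord t - 1|).
  apply/funext => t; rewrite /concat /reverse.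
  have /andP[t0 t1] := coord_bound t.
  case: ifPn => t2; congr (p (clamp _)).
  - rewrite clampE; last by apply/andP; split; lra.
    by rewrite ler0_norm; lra.
  - by move: t2; rewrite -ltNge => t2; rewrite ger0_norm; lra.
apply: (@path_homotopic_reparam p (fun t => clamp `|2 * coord t - 1|) (cst one)) => //.
- apply: continuous_compfun continuous_clamp; exact: continuous_dist_half.
- exact: cst_continuous.
- rewrite /cst coord0 mulr0 sub0r normrN normr1.
  by rewrite -[RHS]clampK coord1.
- rewrite /cst coord1 -[RHS]clampK coord1; congr clamp.
  by rewrite ger0_norm; lra.
Qed.

Lemma path_homotopic_concatpV p : continuous p ->
  path_homotopic (concat p (reverse p)) (cst (p zero)).
Proof.
move=> cp.
have -> : concat p (reverse p) = fun t => p (clamp (-1 * `|2 * coord t - 1| + 1)).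
  apply/funext => t; rewrite /concat /reverse.
  have /andP[t0 t1] := coord_bound t.
  case: ifPn => t2; congr (p (clamp _)).
  - by rewrite ler0_norm; lra.
  - move: t2; rewrite -ltNge => t2; rewrite clampE; last by apply/andP; split; lra.
    by rewrite ger0_norm; lra.
apply: (@path_homotopic_reparam p
  (fun t => clamp (-1 * `|2 * coord t - 1| + 1)) (cst zero)) => //.
- exact/continuous_clamp_affine/continuous_dist_half.
- exact: cst_continuous.
- rewrite /cst coord0 mulr0 sub0r normrN normr1 mulr1 addNr.
  by rewrite -[RHS]clampK coord0.
- rewrite /cst coord1 -[RHS]clampK coord0; congr clamp.
  by rewrite ger0_norm; lra.
Qed.

Lemma path_homotopic_concatA p q r : continuous p -> continuous q ->
  continuous r -> p one = q zero -> q one = r zero ->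
  path_homotopic (concat p (concat q r)) (concat (concat p q) r).
Proof.
move=> cp cq cr pq qr; apply: path_homotopic_sym.
pose phi (t : I) : R :=
  Num.min (2 * coord t + 0) (Num.min (1 * coord t + 4^-1) (2^-1 * coord t + 2^-1)).
have -> : concat (concat p q) r =
    fun t => concat p (concat q r) (clamp (phi t)).
  apply/funext => t; have /andP[t0 t1] := coord_bound t.
  rewrite {1 3}/concat.
  case: (leP (coord t) 2^-1) => t2.
    rewrite /concat clampE; last by apply/andP; split; lra.
    case: (leP (2 * coord t) 2^-1) => t4.
      have -> : phi t = 2 * coord t.
        by rewrite /phi addr0 min_l// le_min; apply/andP; split; lra.
      by rewrite clampE ?t4//; apply/andP; split; lra.
    have -> : phi t = coord t + 4^-1.
      rewrite /phi addr0 mul1r.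
      have -> : Num.min (coord t + 4^-1) (2^-1 * coord t + 2^-1) = coord t + 4^-1.
        by apply: min_l; lra.
      by apply: min_r; lra.
    rewrite clampE; last by apply/andP; split; lra.
    rewrite ifF; last by apply/negbTE; rewrite -ltNge; lra.
    rewrite clampE; last by apply/andP; split; lra.
    rewrite ifT; last by lra.
    by congr (q (clamp _)); lra.
  have -> : phi t = 2^-1 * coord t + 2^-1.
    rewrite /phi mul1r.
    have -> : Num.min (coord t + 4^-1) (2^-1 * coord t + 2^-1) =
        2^-1 * coord t + 2^-1 by apply: min_r; lra.
    by apply: min_r; lra.
  rewrite /concat clampE; last by apply/andP; split; lra.
  rewrite ifF; last by apply/negbTE; rewrite -ltNge; lra.
  rewrite clampE; last by apply/andP; split; lra.
  rewrite ifF; last by apply/negbTE; rewrite -ltNge; lra.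
  by congr (r (clamp _)); lra.
have cqr := continuous_concat cq cr qr.
apply: (@path_homotopic_reparam (concat p (concat q r))
  (fun t => clamp (phi t)) id) => //.
- by apply: continuous_concat => //; rewrite concat0.
- have cmin (f g : I -> R) : continuous f -> continuous g ->
      continuous (fun t => Num.min (f t) (g t)).
    by move=> cf cg t; apply: continuous_min; [exact: cf|exact: cg].
  have ca a b := @continuous_affine I (@coord R) a b continuous_coord.
  by apply: continuous_compfun continuous_clamp; do 2?apply: (cmin).
- by move=> t; exact: cvg_id.
- rewrite -[RHS]clampK coord0; congr clamp; rewrite /phi coord0 !mulr0 !add0r.
  by rewrite min_l// le_min; apply/andP; split; lra.
- rewrite -[RHS]clampK coord1; congr clamp; rewrite /phi coord1.
  have -> : Num.min (1 * 1 + 4^-1) (2^-1 * 1 + 2^-1) = 1 :> R.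
    by rewrite min_r; lra.
  by apply: min_r; lra.
Qed.

End path_homotopy.

Section fundamental_group.
Context (R : realType) (X : topologicalType) (x : X).
Local Notation loop := {path (unit_interval R) from x to x}.
Implicit Types p q r : loop.

Definition loop_homotopic p q : bool := `[< path_homotopic p q >].

Lemma loop_homotopic_refl : reflexive loop_homotopic.
Proof. by move=> p; apply/asboolP/path_homotopic_refl/cts_fun. Qed.

Lemma loop_homotopic_sym : symmetric loop_homotopic.
Proof.
by move=> p q; apply: asbool_equiv_eq; split; exact: path_homotopic_sym.
Qed.

Lemma loop_homotopic_trans : transitive loop_homotopic.
Proof.
move=> q p r /asboolP pq /asboolP qr; apply/asboolP.
exact: path_homotopic_trans pq qr.
Qed.

Definition loop_homotopy :=
  EquivRel loop_homotopic loop_homotopic_refl loop_homotopic_sym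
    loop_homotopic_trans.

Definition fundamental_group : Type := {eq_quot loop_homotopy}.

HB.instance Definition _ := Choice.on fundamental_group.
HB.instance Definition _ := EqQuotient.on fundamental_group.

Lemma pi_loopP p q :
  \pi_fundamental_group p = \pi_fundamental_group q <-> path_homotopic p q.
Proof. by split=> [/eqmodP /asboolP//|pq]; apply/eqmodP/asboolP. Qed.

Lemma repr_loopP p : path_homotopic (repr (\pi_fundamental_group p)) p.
Proof. by apply/pi_loopP; rewrite reprK. Qed.

Lemma loop_joint p q : p one = q zero.
Proof. by rewrite path_one path_zero. Qed.

Definition loop_one : loop := cst x.

Definition loop_mul p q : loop :=
  mk_path (continuous_concat (@cts_fun _ _ p) (@cts_fun _ _ q) (loop_joint p q))
    (etrans (concat0 p q) path_zero) (etrans (concat1 p q) path_one).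

Definition loop_inv p : loop :=
  mk_path (continuous_reverse (@cts_fun _ _ p))
    (etrans (reverse0 p) path_one) (etrans (reverse1 p) path_zero).

Definition pi1_one : fundamental_group := \pi_fundamental_group loop_one.

Definition pi1_mul (a b : fundamental_group) : fundamental_group :=
  \pi_fundamental_group (loop_mul (repr a) (repr b)).

Definition pi1_inv (a : fundamental_group) : fundamental_group :=
  \pi_fundamental_group (loop_inv (repr a)).

Lemma pi1_mulE p q : pi1_mul (\pi_fundamental_group p) (\pi_fundamental_group q) = \pi_fundamental_group (loop_mul p q).
Proof.
by apply/pi_loopP/path_homotopic_concat; [exact: loop_joint|exact: repr_loopP..].
Qed.

Lemma pi1_invE p : pi1_inv (\pi_fundamental_group p) = \pi_fundamental_group (loop_inv p).
Proof. by apply/pi_loopP/path_homotopic_reverse/repr_loopP. Qed.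

Lemma pi1_mulA : associative pi1_mul.
Proof.
elim/quotW=> p; elim/quotW=> q; elim/quotW=> r.
rewrite (pi1_mulE q r) (pi1_mulE p q) !pi1_mulE.
apply/pi_loopP.
apply: (@path_homotopic_concatA R X p q r);
  by [exact: cts_fun|exact: loop_joint].
Qed.

Lemma pi1_mul1g : left_id pi1_one pi1_mul.
Proof.
elim/quotW=> p; rewrite pi1_mulE; apply/pi_loopP.
by have := @path_homotopic_concat1p R X p (@cts_fun _ _ p); rewrite path_zero.
Qed.

Lemma pi1_mulg1 : right_id pi1_one pi1_mul.
Proof.
elim/quotW=> p; rewrite pi1_mulE; apply/pi_loopP.
by have := @path_homotopic_concatp1 R X p (@cts_fun _ _ p); rewrite path_one.
Qed.

Lemma pi1_mulVg : left_inverse pi1_one pi1_inv pi1_mul.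
Proof.
elim/quotW=> p; rewrite pi1_invE pi1_mulE; apply/pi_loopP.
by have := @path_homotopic_concatVp R X p (@cts_fun _ _ p); rewrite path_one.
Qed.

Lemma pi1_mulgV : right_inverse pi1_one pi1_inv pi1_mul.
Proof.
elim/quotW=> p; rewrite pi1_invE pi1_mulE; apply/pi_loopP.
by have := @path_homotopic_concatpV R X p (@cts_fun _ _ p); rewrite path_zero.
Qed.

HB.instance Definition _ := isGroup.Build fundamental_group
  pi1_mulA pi1_mul1g pi1_mulg1 pi1_mulVg pi1_mulgV.

Lemma pi1_mulgE p q :
  (\pi_fundamental_group p * \pi_fundamental_group q)%g =
    \pi_fundamental_group (loop_mul p q).
Proof. exact: pi1_mulE. Qed.

End fundamental_group.

Section induced_morphism.
Context {R : realType} {X Y : topologicalType} (f : continuousType X Y) (x : X).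

Definition pi1_map (a : fundamental_group R x) : fundamental_group R (f x) :=
  \pi_(fundamental_group R (f x)) (f \o repr a : {path (unit_interval R) from f x to f x}).

Lemma path_homotopic_comp (p q : unit_interval R -> X) :
  path_homotopic p q -> path_homotopic (f \o p) (f \o q).
Proof.
case=> H [cH Hp Hq H0 H1]; exists (f \o H); split=> [|s|s|t|t] /=.
- exact: continuous_compfun cH (@cts_fun _ _ f).
- by rewrite Hp.
- by rewrite Hq.
- by rewrite H0.
- by rewrite H1.
Qed.

Lemma pi1_mapE (p : {path (unit_interval R) from x to x}) :
  pi1_map (\pi_(fundamental_group R x) p) =
    \pi_(fundamental_group R (f x)) (f \o p : {path (unit_interval R) from f x to f x}).
Proof. by apply/pi_loopP/path_homotopic_comp/repr_loopP. Qed.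

Lemma pi1_mapM : {morph pi1_map : a b / (a * b)%g}.
Proof.
elim/quotW=> p; elim/quotW=> q.
rewrite pi1_mulgE (pi1_mapE p) (pi1_mapE q) pi1_mapE pi1_mulgE; congr (\pi _).
by apply/path_eqP => t /=; rewrite /mk_path /concat /=; case: ifP.
Qed.

HB.instance Definition _ := isMultiplicative.Build _ _ pi1_map pi1_mapM.

End induced_morphism.

Section path_components.
Context (R : realType) {X : topologicalType}.

(* Paths in the subspace A are the paths in X with values in A. *)
Definition path_component (A : set X) (x : X) : set X :=
  [set y | exists p : {path (unit_interval R) from x to y}, range p `<=` A].

Definition path_connected (A : set X) : Prop :=
  forall x y, A x -> A y -> path_component A x y.

Definition pi1_trivial_components (A : set X) : Prop :=
  forall x, A x -> forall (c : path_component A x) (g : fundamental_group R c),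
    pi1_map (@incl X (path_component A x)) g = 1%g.

End path_components.

(* The universal property of the free group on S. *)
Definition is_basis (G : groupType) (S : set G) : Prop :=
  forall (H : groupType) (f : S -> H),
    exists! phi : G -> H,
      {morph phi : a b / (a * b)%g} /\ forall s : S, phi (val s) = f s.

Definition is_free_group (G : groupType) : Prop :=
  exists S : set G, is_basis S.

(* Main.v *)
From mathcomp Require Import all_boot all_order all_algebra.
From mathcomp Require Import generic_quotient monoid.
From mathcomp Require Import all_classical all_reals all_analysis.
From mathcomp Require Import homotopy lra.
Require Import Defs.

(** Let the nerve be the bipartite graph whose vertices are the path components
    of [X1] and of [X2], and whose edges are the path components of their
    intersection. Loops inside a vertex die in [X], so a path in [X] matters only
    through the edges that it crosses: the fundamental group of [X] is that of the
    nerve, and hence free on the edges outside a spanning tree.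

    The argument works with elements of the group [G] of loops at [x0] only.
    Chosen paths from [x0] to every point turn each path [p] of [X] into an element
    [path_class p] of [G], multiplicatively. A spanning tree of the nerve, grown
    from the component of [x0] by distance, yields elements [frame j x] with
    [frame j y = frame j x * path_class p] for every path [p] from [x] to [y] in
    the [j]-th set, and with [frame true x = frame false x] on the tree edges
    ([frame_path], [frame_ind]). The quotient
    [crossing x = frame true x / frame false x] depends only on the edge of [x],
    and the basis consists of the values of [crossing] other than [1].

    The basis generates: cutting a loop into pieces that stay in one of the two
    sets writes its class as a product of values of [crossing] and their inverses;
    this is [agree_on_basis].

    The basis is free: given a map [f] from it to a group [H], let [h x] be
    [f (crossing x)], or [1] where [crossing x = 1]. Gluing the two trivial
    coverings with fibre [H] along the transition function [h] gives a covering of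
    [X], and [f] extends to its monodromy. A path lifts to this covering, and so
    does a homotopy, because [h] is constant along paths in the intersection
    ([lift_exists], [lift_slices]). The monodromy takes the prescribed values
    because it is trivial along the spanning tree ([monodromy_frame]). *)

Set Implicit Arguments.
Unset Strict Implicit.
Unset Printing Implicit Defensive.

Import Order.TTheory GRing.Theory Num.Theory.
Import numFieldNormedType.Exports.

Local Open Scope classical_set_scope.
Local Open Scope ring_scope.
Local Open Scope quotient_scope.

(** * Induction along an interval *)

(** The supremum of the [b] that are reached from [a] is reached, and cannot be
    passed only if it is the right end. This is what replaces all subdivisions of
    paths and homotopies into small pieces. *)
Lemma interval_induction (R : realType) (P : R -> R -> Prop) :
  (forall a m b, a <= m -> m <= b -> P a m -> P m b -> P a b) ->
  (forall x : R, exists2 U : set R, nbhs x U &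
     forall a b, a <= b -> `[a, b] `<=` U -> P a b) ->
  forall a b, a <= b -> P a b.
Proof.
move=> glue local a b ab.
have refl x : P x x.
  have [U Ux UP] := local x; apply: UP => // y /=.
  by rewrite in_itv /= -eq_le => /eqP <-; exact: nbhs_singleton.
pose S := [set c | a <= c <= b /\ P a c].
have Sa : S a by split=> //; rewrite lexx.
have supS : has_sup S by split; [exists a|exists b => c [/andP[]]].
have [U Uc UP] := local (sup S).
have [e /= e0 eU] := (nbhs_ballP _ _).1 Uc.
have [c' [/andP[ac' c'b] Pc'] c'e] := sup_adherent e0 supS.
have c'S : c' <= sup S.
  by apply: sup_upper_bound => //; split=> //; rewrite ac'.
pose d := Num.min b (sup S + e / 2).
have c'd : c' <= d by rewrite le_min c'b /=; lra.
have Pd : P a d.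
  apply: (glue _ c') => //; apply: UP => // y /=; rewrite in_itv /= le_min.
  move=> /and3P[c'y _ yS]; apply: eU; rewrite /ball /= ltr_norml; lra.
have dS : d <= sup S.
  apply: sup_upper_bound => //; split=> //.
  by rewrite (le_trans ac' c'd) ge_min lexx.
suff -> : b = d by [].
move: dS; rewrite /d /Num.min; case: ifP => // _; lra.
Qed.

(** * Lifts of paths to a covering given by transition functions *)

Section lifts.
Context {R : realType} {X : topologicalType} {J : Type} (A : J -> set X).
Context {H : groupType} (gam : J -> X -> H).

Definition runs_in (U : set X) (p : R -> X) (a b : R) : Prop :=
  forall r, a <= r <= b -> U (p r).

(** The quotients [gam i x / gam j x] are the transition functions of a covering
    with fibre [H], trivial over each [A j]. In a genuine covering they would be
    locally constant. As [X] may fail to be locally path connected, the cover only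
    provides constancy along paths; this is enough to lift paths. *)
Definition compatible_frames : Prop :=
  forall i j (p : R -> X) a b, continuous p -> a <= b ->
    runs_in (A i) p a b -> runs_in (A j) p a b ->
    (gam i (p a) / gam j (p a) = gam i (p b) / gam j (p b))%g.

(** Over [A j], a sheet of the covering is a level set of [u / gam j]. The condition
    is imposed on every subinterval mapped into [A j], rather than near each
    point, so that lifts restrict and glue without any topology. *)
Definition is_lift (p : R -> X) (a b : R) (u : R -> H) : Prop :=
  forall j s t, a <= s -> s <= t -> t <= b -> runs_in (A j) p s t ->
    (u s / gam j (p s) = u t / gam j (p t))%g.

Lemma runs_in_sub U p a b c d : a <= c -> d <= b ->
  runs_in U p a b -> runs_in U p c d.
Proof. by move=> ac db pU r /andP[cr rd]; apply: pU; lra. Qed.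

Lemma is_lift_sub p a b c d u : a <= c -> d <= b ->
  is_lift p a b u -> is_lift p c d u.
Proof. by move=> ac db pu j s t cs st td; apply: pu => //; lra. Qed.

Lemma is_lift_split p a m b u : a <= m -> m <= b ->
  is_lift p a b u -> is_lift p a m u /\ is_lift p m b u.
Proof. by move=> am mb pu; split; apply: is_lift_sub pu. Qed.

Lemma is_lift_eq p q u v a b : (forall r, a <= r <= b -> p r = q r) ->
  (forall r, a <= r <= b -> u r = v r) -> is_lift p a b u -> is_lift q a b v.
Proof.
move=> pq uv pu j s t ab st tb qj.
rewrite -!uv -?pq; [|lra..].
by apply: pu => // r rst; rewrite pq; [exact: qj|lra].
Qed.

Lemma is_lift_mul p a b u h :
  is_lift p a b u -> is_lift p a b (fun s => (h * u s)%g).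
Proof. by move=> pu j s t ? ? ? ?; rewrite -!mulgA; congr mul; exact: pu. Qed.

Lemma is_lift_glue p a m b u :
  is_lift p a m u -> is_lift p m b u -> is_lift p a b u.
Proof.
move=> am mb j s t as_ st tb pj.
case: (leP t m) => tm; first by apply: (am j s t).
case: (leP m s) => ms; first by apply: (mb j s t).
by rewrite (am j s m) 1?(mb j m t) //; try lra; apply: runs_in_sub pj; lra.
Qed.

(** The lifts of the two halves of a concatenation arise this way from a lift of
    the whole. *)
Lemma is_lift_affine p a b u c d : 0 <= c -> a <= d -> c + d <= b ->
  is_lift p a b u ->
  is_lift (fun s => p (c * s + d)) 0 1 (fun s => u (c * s + d)).
Proof.
move=> c0 ad db pu j s t s0 st t1 pj.
have cs : 0 <= c * s by rewrite mulr_ge0.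
have cst : c * s <= c * t by rewrite ler_wpM2l.
have ct : c * t <= c by rewrite ler_piMr.
apply: pu => //; [lra..|].
move=> r /andP[rs rt].
move: c0; rewrite le_eqVlt => /orP[/eqP c0|c0].
  have -> : r = c * s + d by rewrite -c0 in rs rt *; lra.
  by apply: pj; rewrite lexx.
have -> : r = c * ((r - d) / c) + d by rewrite mulrC divfK ?gt_eqF// subrK.
by apply: pj; rewrite ler_pdivlMr// ler_pdivrMr// !(mulrC _ c); lra.
Qed.

Hypothesis cover : forall x : X, exists j, nbhs x (A j).
Hypothesis gamC : compatible_frames.

Lemma change_frame (p : R -> X) a b i j (g h : H) : continuous p -> a <= b ->
  runs_in (A i) p a b -> runs_in (A j) p a b ->
  (g / gam i (p a) = h / gam i (p b))%g ->
  (g / gam j (p a) = h / gam j (p b))%g.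
Proof.
move=> cp ab pi pj gh.
rewrite -(divgKA (gam i (p a)) g) -(divgKA (gam i (p b)) h) gh.
by congr mul; exact: gamC.
Qed.

Lemma cover_near (T : topologicalType) (p : T -> X) (t : T) : continuous p ->
  exists2 U : set T, nbhs t U & exists j, U `<=` p @^-1` A j.
Proof.
move=> cp; have [j pj] := cover (p t).
by exists (p @^-1` A j); [exact: cp|exists j].
Qed.

Lemma lift_exists (p : R -> X) a b : continuous p -> a <= b ->
  exists u, is_lift p a b u.
Proof.
move=> cp; move: a b; apply: interval_induction.
- move=> a m b am mb [u pu] [v pv].
  (* The right-hand lift is moved to the sheet that the left-hand one reaches. *)
  exists (fun s => if s <= m then u s else u m / v m * v s)%g.
  apply: (@is_lift_glue _ _ m).
    by apply: is_lift_eq pu => // r /andP[_ ->].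
  apply: (is_lift_eq _ _ (is_lift_mul (u m / v m)%g pv)) => // r /andP[mr _].
  case: ifPn => // rm; have -> : r = m by apply/eqP; rewrite eq_le rm.
  by rewrite divgK.
- move=> x; have [U Ux [i Ui]] := cover_near x cp.
  exists U => // a b ab abU; exists (fun s => gam i (p s)).
  move=> j s t as_ st tb pj; apply: (@change_frame _ _ _ i) => //.
    move=> r /andP[sr rt]; apply/Ui/abU; rewrite /= in_itv /=; lra.
  by rewrite !divgg.
Qed.

(** Two lifts differ by left multiplication by a constant, since on a short interval
    both are a constant times the same frame. *)
Lemma lift_unique (p : R -> X) a b u v : continuous p -> a <= b ->
  is_lift p a b u -> is_lift p a b v -> (u a / v a = u b / v b)%g.
Proof.
move=> cp ab; elim/interval_induction: ab u v.
- move=> {}a m {}b am mb ha hb u v pu pv.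
  have [pu1 pu2] := is_lift_split am mb pu.
  have [pv1 pv2] := is_lift_split am mb pv.
  by rewrite (ha u v pu1 pv1) (hb u v pu2 pv2).
- move=> x; have [U Ux [i Ui]] := cover_near x cp.
  exists U => // {}a {}b ab abU u v pu pv.
  have pi : runs_in (A i) p a b.
    by move=> r rab; apply/Ui/abU; rewrite /= in_itv.
  rewrite -[LHS](mulgKA (gam i (p a))^-1%g) -[RHS](mulgKA (gam i (p b))^-1%g).
  by rewrite (pu i a b) // (pv i a b).
Qed.

(** The homotopy lifting property: lifts of the horizontal slices, starting from a
    lift of the left edge, form a lift of each vertical slice. On a rectangle
    mapped into one [A i], moving along three sides transfers the condition from
    the left side to the right side. *)
Lemma lift_slices (K : R -> R -> X) (u : R -> R -> H) a b c d :
  continuous (fun st : R * R => K st.1 st.2) -> a <= b -> c <= d ->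
  (forall t, c <= t <= d -> is_lift (K^~ t) a b (u^~ t)) ->
  is_lift (K a) c d (u a) -> is_lift (K b) c d (u b).
Proof.
move=> cK + cd; elim/interval_induction.
- move=> {}a m {}b am mb ham hmb hu ha.
  have {}hu t (tcd : c <= t <= d) := is_lift_split am mb (hu t tcd).
  apply: hmb => [t tcd|]; first exact: (hu t tcd).2.
  by apply: ham => // t tcd; exact: (hu t tcd).1.
- move=> s0.
  (* A strip around [s0] that works for the whole edge [[c, d]] is obtained by a
     second induction, along that edge. *)
  suff [V Vs0 VP] : exists2 V : set R, nbhs s0 V &
      forall a b, a <= b -> `[a, b] `<=` V ->
        (forall t, c <= t <= d -> is_lift (K^~ t) a b (u^~ t)) ->
        is_lift (K a) c d (u a) -> is_lift (K b) c d (u b).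
    by exists V.
  elim/interval_induction: cd.
  + move=> {}c m {}d cm md [V Vs VP] [W Ws WP].
    exists (V `&` W); first exact: filterI.
    move=> {}a {}b ab; rewrite subsetI => -[abV abW] hu ha.
    have [ha1 ha2] := is_lift_split cm md ha.
    apply: (@is_lift_glue _ _ m).
      by apply: VP ab abV _ ha1 => t tcd; apply: hu; lra.
    by apply: WP ab abW _ ha2 => t tcd; apply: hu; lra.
  + move=> t0; have [U [[V W] /= [Vs Wt] VWU] [i Ui]] := cover_near (s0, t0) cK.
    have {}Ui s t : V s -> W t -> A i (K s t).
      by move=> Vs' Wt'; apply: (Ui (s, t)); apply: VWU.
    exists W => // {}c {}d cd cdW; exists V => // {}a {}b ab abV hu ha.
    move=> j t t' ct tt' t'd bj.
    have inV s : a <= s <= b -> V s by move=> sab; apply: abV; rewrite /= in_itv.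
    have inW r : c <= r <= d -> W r by move=> rcd; apply: cdW; rewrite /= in_itv.
    have hor r : c <= r <= d ->
        (u a r / gam i (K a r) = u b r / gam i (K b r))%g.
      move=> rcd; apply: (hu r rcd i a b) => // s sab.
      by apply: Ui; [exact: inV|exact: inW].
    have runi s : a <= s <= b -> runs_in (A i) (K s) t t'.
      move=> sab r rtt; apply: Ui; first exact: inV.
      by apply: inW; lra.
    apply: (@change_frame (K b) t t' i) => //.
    * have cb : continuous (fun r : R => (b, r)).
        by apply: continuous_pair => r; [exact: cvg_cst|exact: cvg_id].
      exact: (continuous_compfun cb cK).
    * by apply: runi; rewrite ab lexx.
    * rewrite -!hor; [|lra..].
      by apply: ha => //; apply: runi; rewrite ab lexx.
Qed.
End lifts.

(** * Paths parametrised by real intervals *)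

Section real_paths.
Context {R : realType} {X : topologicalType}.
Local Notation I := (unit_interval R).

(** Paths on the whole line have restrictions to arbitrary intervals, to which
    induction along an interval applies. *)
Definition extend (p : I -> X) (r : R) : X := p (clamp r).

Lemma continuous_extend p : continuous p -> continuous (extend p).
Proof. by move=> cp; apply: continuous_compfun cp; exact: continuous_clamp. Qed.

Lemma extend0 p : extend p 0 = p zero. Proof. by rewrite /extend clamp0. Qed.

Lemma extend1 p : extend p 1 = p one. Proof. by rewrite /extend clamp1. Qed.

(** The straight-line homotopy between the two parameters. *)
Lemma path_homotopic_reparam_real (p : R -> X) (f g : I -> R) :
  continuous p -> continuous f -> continuous g ->
  f zero = g zero -> f one = g one -> path_homotopic (p \o f) (p \o g).
Proof.
move=> cp cf cg fg0 fg1.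
exists (fun st : I * I => p (f st.1 + coord st.2 * (g st.1 - f st.1))).
have cfst (h : I -> R) : continuous h -> continuous (fun st : I * I => h st.1).
  by move=> ch; apply: continuous_compfun ch => st; exact: cvg_fst.
split=> [|s|s|t|t] /=.
- apply: continuous_compfun cp => st; apply: cvgD; first exact: cfst.
  apply: cvgM; first exact: continuous_coord_snd.
  by apply: cvgB; exact: cfst.
- by rewrite coord0 mul0r addr0.
- by rewrite coord1 mul1r addrC subrK.
- by rewrite fg0 subrr mulr0 addr0.
- by rewrite fg1 subrr mulr0 addr0.
Qed.

Definition affine_segment (a b : R) (t : I) : R := (b - a) * coord t + a.

Lemma continuous_affine_segment a b : continuous (affine_segment a b).
Proof. exact/continuous_affine/continuous_coord. Qed.

Lemma affine_segment0 a b : affine_segment a b zero = a.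
Proof. by rewrite /affine_segment coord0 mulr0 add0r. Qed.

Lemma affine_segment1 a b : affine_segment a b one = b.
Proof. by rewrite /affine_segment coord1 mulr1 subrK. Qed.

Definition segment (p : R -> X) (cp : continuous p) (a b : R) :
    {path I from p a to p b} :=
  mk_path (continuous_compfun (@continuous_affine_segment a b) cp)
    (congr1 p (affine_segment0 a b)) (congr1 p (affine_segment1 a b)).

Lemma range_segment (p : R -> X) (cp : continuous p) (U : set X) a b :
  a <= b -> runs_in U p a b -> range (segment cp a b) `<=` U.
Proof.
move=> ab pU _ [t _ <-]; have /andP[t0 t1] := coord_bound t.
apply: pU; rewrite lerDr mulr_ge0 ?subr_ge0 //=.
by rewrite -lerBrDr ler_piMr ?subr_ge0.
Qed.
End real_paths.

(** * Composition of paths up to homotopy *)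

Section path_groupoid.
Context {R : realType} {X : topologicalType}.
Local Notation I := (unit_interval R).
Local Notation "x ~> y" := {path I from x to y} (at level 60).
Implicit Types x y z t : X.

Lemma path_joint x y z (p : x ~> y) (q : y ~> z) : p one = q zero.
Proof. exact: (etrans path_one (esym path_zero)). Qed.

Definition path_cat (x y z : X) (p : x ~> y) (q : y ~> z) : x ~> z :=
  mk_path (continuous_concat (@cts_fun _ _ p) (@cts_fun _ _ q)
      (path_joint p q))
    (etrans (concat0 p q) path_zero) (etrans (concat1 p q) path_one).

Definition path_inv (x y : X) (p : x ~> y) : y ~> x :=
  mk_path (continuous_reverse (@cts_fun _ _ p))
    (etrans (reverse0 p) path_one) (etrans (reverse1 p) path_zero).

Definition path_id (x : X) : x ~> x := cst x.

Lemma range_path_cat x y z (p : x ~> y) (q : y ~> z) (U : set X) :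
  range p `<=` U -> range q `<=` U -> range (path_cat p q) `<=` U.
Proof.
move=> pU qU _ [t _ <-]; rewrite /path_cat /= /mk_path /concat.
by case: ifP => _; [apply: pU|apply: qU].
Qed.

Lemma range_path_inv x y (p : x ~> y) (U : set X) :
  range p `<=` U -> range (path_inv p) `<=` U.
Proof. by move=> pU _ [t _ <-]; apply: pU. Qed.

Lemma homotopic_refl x y (p : x ~> y) : path_homotopic p p.
Proof. exact/path_homotopic_refl/cts_fun. Qed.

Lemma homotopic_cat x y z (p p' : x ~> y) (q q' : y ~> z) :
  path_homotopic p p' -> path_homotopic q q' ->
  path_homotopic (path_cat p q) (path_cat p' q').
Proof.
exact/path_homotopic_concat/path_joint.
Qed.

Lemma homotopic_catA x y z t (p : x ~> y) (q : y ~> z) (r : z ~> t) :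
  path_homotopic (path_cat p (path_cat q r)) (path_cat (path_cat p q) r).
Proof.
by apply: path_homotopic_concatA;
  [exact: cts_fun..|exact: path_joint|exact: path_joint].
Qed.

Lemma homotopic_cat1p x y (p : x ~> y) :
  path_homotopic (path_cat (path_id x) p) p.
Proof.
have := @path_homotopic_concat1p R X p (@cts_fun _ _ p).
by rewrite path_zero.
Qed.

Lemma homotopic_catVp x y (p : x ~> y) :
  path_homotopic (path_cat (path_inv p) p) (path_id y).
Proof.
have := @path_homotopic_concatVp R X p (@cts_fun _ _ p).
by rewrite path_one.
Qed.

Lemma homotopic_catpV x y (p : x ~> y) :
  path_homotopic (path_cat p (path_inv p)) (path_id x).
Proof.
have := @path_homotopic_concatpV R X p (@cts_fun _ _ p).
by rewrite path_zero.
Qed.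

Lemma homotopic_catKp x y z (p : x ~> y) (q : y ~> z) :
  path_homotopic (path_cat (path_inv p) (path_cat p q)) q.
Proof.
apply: path_homotopic_trans (homotopic_catA _ _ _) _.
apply: path_homotopic_trans (homotopic_cat1p q).
by apply: homotopic_cat; [exact: homotopic_catVp|exact: homotopic_refl].
Qed.

(** Both sides are reparametrisations of [p] along paths of the real line from [a]
    to [b]. *)
Lemma homotopic_segment (p : R -> X) (cp : continuous p) a m b :
  path_homotopic (path_cat (segment cp a m) (segment cp m b)) (segment cp a b).
Proof.
rewrite (_ : path_cat _ _ =
    p \o concat (affine_segment a m) (affine_segment m b) :> (I -> X)); last first.
  by apply/funext => t; rewrite /path_cat /= /mk_path /concat; case: ifP.
apply: path_homotopic_reparam_real => //.
- apply: continuous_concat; try exact: continuous_affine_segment.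
  by rewrite affine_segment0 affine_segment1.
- exact: continuous_affine_segment.
- by rewrite concat0 !affine_segment0.
- by rewrite concat1 !affine_segment1.
Qed.
End path_groupoid.

(** * Holonomy *)

Section holonomy.
Context {R : realType} {X : topologicalType} {J : Type} (A : J -> set X).
Context {H : groupType} (gam : J -> X -> H).
Local Notation I := (unit_interval R).
Local Notation "x ~> y" := {path I from x to y} (at level 60).
Implicit Types x y z : X.
Hypothesis cover : forall x : X, exists j, nbhs x (A j).
Hypothesis gamC : @compatible_frames R X J A H gam.

Let holonomies (p : I -> X) : set H :=
  [set h | exists2 u, is_lift A gam (extend p) 0 1 u & h = ((u 0)^-1 * u 1%R)%g].

(** The set [holonomies p] is a singleton for continuous [p], so the default value
    only concerns functions that are not paths. *)
Definition holonomy (p : I -> X) : H := xget 1%g (holonomies p).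

Lemma holonomyE (p : I -> X) u : continuous p ->
  is_lift A gam (extend p) 0 1 u -> holonomy p = ((u 0)^-1 * u 1%R)%g.
Proof.
move=> cp pu; rewrite /holonomy; case: xgetP => [_ ->|/(_ ((u 0)^-1 * u 1%R)%g)].
  move=> [v pv ->].
  have /esym := lift_unique cover (continuous_extend cp) ler01 pv pu.
  by move=> vu; rewrite -[v 1](divgK (u 1)) vu -mulgA mulKg.
by case; exists u.
Qed.

Lemma holonomy_lift (p : I -> X) : continuous p ->
  exists2 u, is_lift A gam (extend p) 0 1 u & u 0 = 1%g /\ u 1 = holonomy p.
Proof.
move=> cp; have [u pu] := lift_exists cover gamC (continuous_extend cp) ler01.
exists (fun s => (u 0)^-1 * u s)%g; first exact: is_lift_mul.
by rewrite mulVg (holonomyE cp pu).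
Qed.

(** The endpoints stay fixed during a homotopy, so along the edges of the square
    that they trace a lift is constant. *)
Lemma holonomy_homotopic (p q : I -> X) : continuous p -> continuous q ->
  path_homotopic p q -> holonomy p = holonomy q.
Proof.
move=> cp cq [K [cK Kp Kq K0 K1]].
pose L (s t : R) := K (clamp s, clamp t).
have cL : continuous (fun st : R * R => L st.1 st.2).
  apply: continuous_compfun cK; apply: continuous_pair;
    apply: continuous_compfun continuous_clamp => st;
    by [exact: cvg_fst|exact: cvg_snd].
have cLt t : continuous (L^~ t).
  have ct : continuous (fun s : R => (s, t)).
    by apply: continuous_pair => s; [exact: cvg_id|exact: cvg_cst].
  exact: (continuous_compfun ct cL).
have /choice[u hu] t : exists u, is_lift A gam (L^~ t) 0 1 u /\ u 0 = 1%g.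
  have [u pu] := lift_exists cover gamC (cLt t) ler01.
  exists (fun s => (u 0)^-1 * u s)%g; split; last by rewrite mulVg.
  exact: is_lift_mul.
have L0 : is_lift A gam (L 0) 0 1 (fun t => u t 0).
  by move=> j s t _ _ _ _; rewrite !(hu _).2 /L clamp0 !K0.
have L1 : is_lift A gam (L 1) 0 1 (fun t => u t 1).
  by apply: (lift_slices cover gamC (u := fun s t => u t s) cL ler01 ler01 _ L0)
    => t _; case: (hu t).
have u01 : u 0 1 = u 1 1.
  have [j /nbhs_singleton pj] := cover (p one).
  have := L1 j 0 1; rewrite lexx ler01 lexx /L clamp1 !K1 => H1.
  by apply: (mulIg _ _ _ (H1 _ _ _ _)) => // r _; rewrite K1.
have pu : is_lift A gam (extend p) 0 1 (u 0).
  by apply: is_lift_eq (hu 0).1 => // r _; rewrite /L clamp0 Kp.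
have qu : is_lift A gam (extend q) 0 1 (u 1).
  by apply: is_lift_eq (hu 1).1 => // r _; rewrite /L clamp1 Kq.
by rewrite (holonomyE cp pu) (holonomyE cq qu) !(hu _).2 u01.
Qed.

Lemma holonomy_cat x y z (p : x ~> y) (q : y ~> z) :
  holonomy (path_cat p q) = (holonomy p * holonomy q)%g.
Proof.
have [u pqu [u0 u1]] := holonomy_lift (@cts_fun _ _ (path_cat p q)).
have half0 : 0 <= 2^-1 :> R by lra.
have pu : is_lift A gam (extend p) 0 1 (fun s => u (2^-1 * s + 0)).
  have := is_lift_affine half0 (lexx 0) _ pqu; rewrite addr0.
  move=> /(_ ltac:(lra)); apply: is_lift_eq => // r r01.
  rewrite /extend /path_cat /= /mk_path /concat clampE; last lra.
  rewrite ifT; last lra.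
  by congr (p (clamp _)); lra.
have qu : is_lift A gam (extend q) 0 1 (fun s => u (2^-1 * s + 2^-1)).
  have := is_lift_affine half0 half0 _ pqu.
  move=> /(_ ltac:(lra)); apply: is_lift_eq => // r r01.
  rewrite /extend /path_cat /= /mk_path /concat clampE; last lra.
  case: ifPn => r2; last by congr (q (clamp _)); lra.
  have -> : r = 0 by lra.
  rewrite clamp0 path_zero (_ : 2 * _ = 1); last lra.
  by rewrite clamp1 path_one.
rewrite -u1 (holonomyE _ pu) ?(holonomyE _ qu); [|exact: cts_fun..].
rewrite !mulr0 !add0r !mulr1 addr0 u0 invg1 mul1g mulVKg.
by congr u; lra.
Qed.

(** Inside a single [A j] the frame itself is a lift. *)
Lemma holonomy_frames (p : I -> X) j : continuous p -> range p `<=` A j ->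
  holonomy p = ((gam j (p zero))^-1 * gam j (p one))%g.
Proof.
move=> cp pj; have [u pu [u0 <-]] := holonomy_lift cp.
have := pu j 0 1 (lexx 0) ler01 (lexx 1).
rewrite extend0 extend1 u0 div1g => -> //; first by rewrite divgK.
by move=> r _; apply: pj; exists (clamp r).
Qed.

Lemma holonomy_id x : holonomy (path_id x) = 1%g.
Proof.
have [j /nbhs_singleton xj] := cover x.
rewrite (@holonomy_frames _ j) ?mulVg //; first exact: cts_fun.
by move=> _ [t _ <-].
Qed.

Lemma holonomy_inv x y (p : x ~> y) : holonomy (path_inv p) = (holonomy p)^-1%g.
Proof.
apply/esym/mulg1_eq; rewrite -holonomy_cat -(holonomy_id x).
by apply: holonomy_homotopic; [exact: cts_fun..|exact: homotopic_catpV].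
Qed.
End holonomy.

(** * Paths as elements of the fundamental group *)

Section path_class.
Context {R : realType} {X : topologicalType} (x0 : X).
Local Notation I := (unit_interval R).
Local Notation "x ~> y" := {path I from x to y} (at level 60).
Local Notation G := (fundamental_group R x0).
Implicit Types x y z : X.
Context (spoke : forall x, x0 ~> x).
Hypothesis spoke0 : path_homotopic (spoke x0) (path_id x0).

(** Closing every path up with the chosen [spoke] at each end maps the
    fundamental groupoid to the group at [x0]. *)
Definition path_class x y (q : x ~> y) : G :=
  \pi_(fundamental_group R x0)
    (path_cat (spoke x) (path_cat q (path_inv (spoke y)))).

Lemma path_class_homotopic x y (p q : x ~> y) :
  path_homotopic p q -> path_class p = path_class q.
Proof.
move=> pq; apply/pi_loopP; apply: homotopic_cat; first exact: homotopic_refl.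
by apply: homotopic_cat => //; exact: homotopic_refl.
Qed.

(** The endpoints are part of the type of a path; this compares paths whose
    endpoints are equal without being convertible. *)
Lemma path_class_eq x y x' y' (p : x ~> y) (q : x' ~> y') :
  p =1 q -> path_class p = path_class q.
Proof.
move=> pq.
have xx : x = x' by rewrite -(path_zero (s := p)) -(path_zero (s := q)) pq.
have yy : y = y' by rewrite -(path_one (s := p)) -(path_one (s := q)) pq.
by case: _ / xx yy q pq => yy; case: _ / yy => q /path_eqP ->.
Qed.

(** The spoke at the middle point is run back and forth, and cancels. *)
Lemma path_class_cat x y z (p : x ~> y) (q : y ~> z) :
  path_class (path_cat p q) = (path_class p * path_class q)%g.
Proof.
rewrite [RHS]pi1_mulgE; apply/pi_loopP/path_homotopic_sym.
set dx := spoke x; set dy := spoke y; set r := path_inv (spoke z).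
apply: (@path_homotopic_trans _ _ _
  (path_cat dx (path_cat (path_cat p (path_inv dy))
                         (path_cat dy (path_cat q r))))).
  apply: path_homotopic_sym; exact: homotopic_catA.
apply: homotopic_cat; first exact: homotopic_refl.
apply: (@path_homotopic_trans _ _ _
  (path_cat p (path_cat (path_inv dy) (path_cat dy (path_cat q r))))).
  apply: path_homotopic_sym; exact: homotopic_catA.
apply: (@path_homotopic_trans _ _ _ (path_cat p (path_cat q r))).
  by apply: homotopic_cat; [exact: homotopic_refl|exact: homotopic_catKp].
exact: homotopic_catA.
Qed.

Lemma path_class_id x : path_class (path_id x) = 1%g.
Proof.
apply: (mulIg (path_class (path_id x))); rewrite mul1g -path_class_cat.
by apply: path_class_homotopic; exact: homotopic_cat1p.
Qed.

Lemma path_class_inv x y (p : x ~> y) :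
  path_class (path_inv p) = (path_class p)^-1%g.
Proof.
apply/esym/mulg1_eq; rewrite -path_class_cat -(path_class_id x).
by apply: path_class_homotopic; exact: homotopic_catpV.
Qed.

Lemma path_class_loop (p : x0 ~> x0) :
  path_class p = \pi_(fundamental_group R x0) p.
Proof.
apply/pi_loopP.
apply: (@path_homotopic_trans _ _ _
  (path_cat (path_id x0) (path_cat p (path_id x0)))).
  apply: homotopic_cat => //; apply: homotopic_cat; first exact: homotopic_refl.
  have := homotopic_catpV (spoke x0); apply: path_homotopic_trans.
  apply: path_homotopic_sym.
  apply: (path_homotopic_trans (homotopic_cat spoke0 (homotopic_refl _))).
  exact: homotopic_cat1p.
apply: (path_homotopic_trans (homotopic_cat1p _)).
have := @path_homotopic_concatp1 R X p (@cts_fun _ _ p).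
by rewrite path_one.
Qed.
End path_class.

(** * Subspaces whose loops are null-homotopic *)

Section null_loops.
Context {R : realType} {X : topologicalType} (A : set X).
Local Notation I := (unit_interval R).
Local Notation "x ~> y" := {path I from x to y} (at level 60).
Implicit Types x y z : X.

Lemma path_component_refl x : A x -> path_component R A x x.
Proof. by move=> Ax; exists (path_id x) => _ [t _ <-]. Qed.

Lemma path_component_sym x y :
  path_component R A x y -> path_component R A y x.
Proof. by move=> [p pA]; exists (path_inv p); exact: range_path_inv. Qed.

Lemma path_component_trans x y z : path_component R A x y ->
  path_component R A y z -> path_component R A x z.
Proof.
by move=> [p pA] [q qA]; exists (path_cat p q); exact: range_path_cat.
Qed.

Lemma path_component_subl x y : path_component R A x y -> A x.
Proof. by move=> [p pA]; apply: pA; exists zero => //; exact: path_zero. Qed.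

Lemma path_component_subr x y : path_component R A x y -> A y.
Proof. by move=> /path_component_sym /path_component_subl. Qed.

Lemma path_component_eq x y : path_component R A x y ->
  path_component R A x = path_component R A y.
Proof.
move=> xy; apply/seteqP; split=> z; last exact: path_component_trans.
exact/path_component_trans/path_component_sym.
Qed.

(** The part of [p] before [t] joins [x] to [p t] inside [A]. *)
Lemma path_in_component x y (p : x ~> y) : range p `<=` A ->
  forall t, path_component R A x (p t).
Proof.
move=> pA t; have cp := @cts_fun _ _ p.
have p0 : extend p 0 = x by rewrite extend0 path_zero.
have pt : extend p (coord t) = p t by rewrite /extend clampK.
have : path_component R A (extend p 0) (extend p (coord t)).
  exists (segment (continuous_extend cp) 0 (coord t)); apply: range_segment.
    by case/andP: (coord_bound t).
  by move=> r _; apply: pA; exists (clamp r).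
by rewrite p0 pt.
Qed.

Hypothesis nullA : pi1_trivial_components R A.

(** A loop in [A] stays in one path component, so it is the image of a loop of that
    component under the inclusion. *)
Lemma loop_null_homotopic x (p : x ~> x) : range p `<=` A ->
  path_homotopic p (path_id x).
Proof.
move=> pA; have Ax : A x by apply: pA; exists zero => //; exact: path_zero.
pose C := path_component R A x.
have pC t : p t \in C by apply/mem_set/path_in_component.
have xC : x \in C by apply/mem_set/path_component_refl.
pose c : C := SigSub xC.
pose q (t : I) : C := SigSub (pC t).
have cq : continuous q by apply: continuous_subtype; exact: (@cts_fun _ _ p).
have q0 : q zero = c by apply/val_inj; exact: path_zero.
have q1 : q one = c by apply/val_inj; exact: path_one.
have := nullA Ax (\pi_(fundamental_group R c) (mk_path cq q0 q1)).
by rewrite pi1_mapE => qE; apply: ((pi_loopP _ (loop_one R x)).1 qE).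
Qed.

Lemma path_class_unique x0 (spoke : forall x, x0 ~> x) x y (p q : x ~> y) :
  range p `<=` A -> range q `<=` A ->
  path_class spoke p = path_class spoke q.
Proof.
move=> pA qA; apply: divg1_eq; rewrite -path_class_inv -path_class_cat.
rewrite -(path_class_id spoke x).
apply/path_class_homotopic/loop_null_homotopic.
exact: range_path_cat pA (range_path_inv qA).
Qed.
End null_loops.

(** * A spanning tree of the nerve and the frames along it *)

Section frames.
Context {R : realType} {X : topologicalType} (x0 : X) (A : bool -> set X).
Local Notation I := (unit_interval R).
Local Notation "x ~> y" := {path I from x to y} (at level 60).
Local Notation G := (fundamental_group R x0).
Implicit Types x y z : X.
Local Notation C j := (path_component R (A j)).
Context (spoke : forall x, x0 ~> x).
Hypothesis X_connected : path_connected R [set: X].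
Hypothesis cover : forall x : X, exists j, nbhs x (A j).
Hypothesis nullA : forall j, pi1_trivial_components R (A j).
Hypothesis Ax0 : A true x0.

(** Along a path in [X] one stays in a path component of some [A j] until one
    switches to the other set at a common point: the nerve is connected because
    [X] is. *)
Lemma cover_path_ind (Z : bool -> X -> Prop) :
  (forall j x y, C j x y -> Z j x -> Z j y) ->
  (forall i j x, A i x -> A j x -> Z i x -> Z j x) ->
  forall i j x y, A i x -> A j y -> Z i x -> Z j y.
Proof.
move=> Zpath Zswitch i j x y Aix Ajy Zix.
have [p _] := X_connected (x := x) (y := y) Logic.I Logic.I.
have cp := continuous_extend (@cts_fun _ _ p).
have ind a b : a <= b -> (forall i, A i (extend p a) -> Z i (extend p a)) ->
    (forall j, A j (extend p b) -> Z j (extend p b)).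
  move: a b; apply: interval_induction.
    by move=> a m b _ _ am mb /am /mb.
  move=> r; have [U Ur [l Ul]] := cover_near cover r cp.
  exists U => // a b ab abU Za k Akb.
  have pl : runs_in (A l) (extend p) a b.
    by move=> s sab; apply/Ul/abU; rewrite /= in_itv.
  apply: (Zswitch l) => //; first by apply: pl; rewrite ab lexx.
  apply: (Zpath _ (extend p a)); last by apply/Za/pl; rewrite ab lexx.
  by exists (segment cp a b); exact: range_segment.
have := ind 0 1 ler01; rewrite extend0 extend1 path_zero path_one; apply=> //.
by move=> k Akx; exact: Zswitch Zix.
Qed.

(** Any path in [A j] from [x] to [y] gives the same element, by
    [path_class_unique]. *)
Definition transport j x y : G :=
  if pselect (C j x y) is left xy then path_class spoke (projT1 (cid xy))
  else 1%g.

Lemma transportE j x y (p : x ~> y) : range p `<=` A j ->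
  transport j x y = path_class spoke p.
Proof.
move=> pA; rewrite /transport; case: pselect => [xy|]; last by case; exists p.
by apply: (path_class_unique (@nullA j)) => //; exact: (projT2 (cid xy)).
Qed.

Lemma transport_id j x : A j x -> transport j x x = 1%g.
Proof.
move=> Ajx; rewrite (@transportE _ _ _ (path_id x)) ?path_class_id //.
by move=> _ [t _ <-].
Qed.

Lemma transport_trans j x y z : C j x y -> C j y z ->
  transport j x z = (transport j x y * transport j y z)%g.
Proof.
move=> [p pA] [q qA]; rewrite (transportE pA) (transportE qA) -path_class_cat.
by apply: transportE; exact: range_path_cat.
Qed.

(** The vertices of the nerve at distance at most [n] from the component of [x0];
    a vertex is represented by all its points. *)
Fixpoint reach n j : set X :=
  if n is m.+1 then
    [set x | reach m j x \/ exists2 y, C j x y & reach m (~~ j) y]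
  else if j then C true x0 else set0.

Lemma reach_path n j x y : C j x y -> reach n j x -> reach n j y.
Proof.
elim: n j => [|n IHn] j /= xy.
  by case: j xy => // + x0x; exact: path_component_trans x0x.
case=> [/(IHn _ xy)|[z xz nz]]; first by left.
right; exists z => //.
exact: path_component_trans (path_component_sym xy) xz.
Qed.

Lemma reach_sub n j : reach n j `<=` A j.
Proof.
elim: n j => [|n IHn] j x /=; first by case: j => // /path_component_subr.
by case=> [/IHn//|[y /path_component_subl]].
Qed.

(** A point where the component of [x] meets one that is closer to the root: the
    edge of the spanning tree towards the parent. The default [x0] does not
    mention [x], so that all points of a component share their door. *)
Definition door n j x : X :=
  xget x0 [set y | C j x y /\ reach n (~~ j) y].

Lemma doorP n j x : reach n.+1 j x -> ~ reach n j x ->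
  C j x (door n j x) /\ reach n (~~ j) (door n j x).
Proof.
by move=> /= [//|[y xy ny]] _; rewrite /door; case: xgetP => // /(_ y) [].
Qed.

Lemma door_eq n j x y : C j x y -> door n j x = door n j y.
Proof. by move=> /path_component_eq xy; rewrite /door xy. Qed.

(** The class of the path from [x0] to [x] that follows the spanning tree: enter the
    component of [x] by its door, then walk inside the component. *)
Fixpoint level_frame n j x : G :=
  if n is m.+1 then
    if pselect (reach m j x) then level_frame m j x
    else (level_frame m (~~ j) (door m j x) * transport j (door m j x) x)%g
  else transport true x0 x.

Lemma level_frame_path n j x y : reach n j x -> C j x y ->
  level_frame n j y = (level_frame n j x * transport j x y)%g.
Proof.
elim: n j x y => [|n IHn] j x y.
  by case: j => //= x0x xy; exact: transport_trans.
move=> nx xy; rewrite /=; case: pselect => ny; case: pselect => nx'.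
- exact: IHn.
- by case: nx'; exact: reach_path (path_component_sym xy) ny.
- by case: ny; exact: reach_path xy nx'.
- have [xd _] := doorP nx nx'.
  rewrite -(door_eq n xy) -mulgA; congr mul.
  by apply: transport_trans xy; exact: path_component_sym.
Qed.

Lemma level_frame_stable n k j x : reach n j x ->
  reach (n + k) j x /\ level_frame (n + k) j x = level_frame n j x.
Proof.
move=> nx; elim: k => [|k [IHr IHe]]; first by rewrite addn0.
rewrite addnS /=; split; first by left.
by case: pselect.
Qed.

(** Any [n] with [reach n j x] gives the same value, because [level_frame] does not
    change once [x] is reached. *)
Definition frame j x : G := level_frame (xget 0%N [set n | reach n j x]) j x.

Lemma frameE n j x : reach n j x -> frame j x = level_frame n j x.
Proof.
move=> nx; rewrite /frame; case: xgetP => [m _ mx|/(_ n)//].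
have [_ <-] := level_frame_stable n mx; have [_ <-] := level_frame_stable m nx.
by rewrite addnC.
Qed.

Lemma reach_all j x : A j x -> exists n, reach n j x.
Proof.
move=> Ajx.
apply: (@cover_path_ind (fun j x => exists n, reach n j x) _ _ true j x0) => //.
- by move=> i y z yz [n ny]; exists n; exact: reach_path ny.
- move=> i k y Aiy Aky [n ny]; case: (eqVneq i k) => [<-|ik]; first by exists n.
  exists n.+1; right; exists y; first exact: path_component_refl.
  by rewrite (_ : ~~ k = i) //; case: i k ik {Aiy Aky ny} => [] [].
- by exists 0%N; exact: path_component_refl.
Qed.

Lemma frame_path j x y (p : x ~> y) : range p `<=` A j ->
  frame j y = (frame j x * path_class spoke p)%g.
Proof.
move=> pA; have xy : C j x y by exists p.
have [n nx] := reach_all (path_component_subl xy).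
rewrite (frameE nx) (frameE (reach_path xy nx)) (level_frame_path nx xy).
by rewrite (transportE pA).
Qed.

Lemma frame_base : frame true x0 = 1%g.
Proof.
have x00 : C true x0 x0 by exact: path_component_refl.
by rewrite (@frameE 0%N) //= transport_id.
Qed.

(** Induction along the spanning tree, whose edges are seen only through the fact
    that both frames agree at every door, by construction. *)
Lemma frame_ind (Z : bool -> X -> Prop) : Z true x0 ->
  (forall j x y, C j x y -> Z j x -> Z j y) ->
  (forall j x, A true x -> A false x -> frame true x = frame false x ->
     Z j x -> Z (~~ j) x) ->
  forall j x, A j x -> Z j x.
Proof.
move=> Z0 Zpath Zswitch j x /reach_all[n].
elim: n j x => [|n IHn] j x nx.
  by case: j nx => //= x0x; exact: Zpath Z0.
have [|nx'] := pselect (reach n j x); first exact: IHn.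
have [xd nd] := doorP nx nx'.
set y := door n j x in xd nd.
have yx := path_component_sym xd.
have ny : reach n.+1 j y := reach_path xd nx.
have ny' : ~ reach n j y by move=> /(reach_path yx).
have Ajy := reach_sub ny; have Ajy' := reach_sub nd.
have yy : frame j y = frame (~~ j) y.
  rewrite (frameE ny) (frameE nd) /=; case: pselect => // ?.
  by rewrite -(door_eq n xd) -/y transport_id // mulg1.
apply: (Zpath _ _ _ yx); rewrite -(negbK j); apply: Zswitch; last exact: IHn.
- by case: (j) Ajy Ajy'.
- by case: (j) Ajy Ajy'.
- by case: (j) yy.
Qed.
End frames.

(** Preceding arbitrary spokes with the inverse of the one at [x0] makes the one at
    [x0] trivial up to homotopy. *)
Lemma spokes_exist (R : realType) (X : topologicalType) (x0 : X) :
  path_connected R [set: X] ->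
  exists spoke : forall x, {path unit_interval R from x0 to x},
    path_homotopic (spoke x0) (path_id x0).
Proof.
move=> Xc; have e x := projT1 (cid (Xc x0 x Logic.I Logic.I)).
exists (fun x => path_cat (path_inv (e x0)) (e x)); exact: homotopic_catVp.
Qed.

Lemma morph_div (G H : groupType) (f : G -> H) :
  {morph f : a b / (a * b)%g} -> {morph f : a b / (a / b)%g}.
Proof.
move=> fM a b; have fba : (f (a / b) * f b)%g = f a by rewrite -fM divgK.
by rewrite -fba mulgK.
Qed.

Lemma morph_one (G H : groupType) (f : G -> H) :
  {morph f : a b / (a * b)%g} -> f 1%g = 1%g.
Proof. by move=> /morph_div fD; rewrite -(divgg 1%g) fD divgg. Qed.

(** * The basis *)

Section nerve_basis.
Context {R : realType} {X : topologicalType} (x0 : X) (A : bool -> set X).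
Local Notation I := (unit_interval R).
Local Notation "x ~> y" := {path I from x to y} (at level 60).
Local Notation G := (fundamental_group R x0).
Implicit Types x y z : X.
Context (spoke : forall x, x0 ~> x).
Hypothesis spoke0 : path_homotopic (spoke x0) (path_id x0).
Hypothesis X_connected : path_connected R [set: X].
Hypothesis cover : forall x : X, exists j, nbhs x (A j).
Hypothesis nullA : forall j, pi1_trivial_components R (A j).
Hypothesis Ax0 : A true x0.

Local Notation frm := (frame A spoke).

(** The loop that goes to [x] along the tree through the first set and comes back
    through the second one. *)
Definition crossing x : G := (frm true x / frm false x)%g.

(** The edges of the spanning tree have trivial crossing, and are left out in this
    way. *)
Definition nerve_basis : set G :=
  [set g | g <> 1%g /\ exists x, [/\ A true x, A false x & g = crossing x]].

Lemma crossing_invariant x y (p : x ~> y) :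
  range p `<=` A true -> range p `<=` A false -> crossing x = crossing y.
Proof.
move=> p1 p2; rewrite /crossing.
rewrite (frame_path spoke X_connected cover nullA Ax0 p1).
by rewrite (frame_path spoke X_connected cover nullA Ax0 p2) mulgKA.
Qed.

Section agreement.
Context {H : groupType} (f g : G -> H).
Hypothesis fM : {morph f : a b / (a * b)%g}.
Hypothesis gM : {morph g : a b / (a * b)%g}.
Hypothesis fg : forall a, nerve_basis a -> f a = g a.

Lemma agree_frames i j x : A i x -> A j x ->
  f (frm i x / frm j x)%g = g (frm i x / frm j x)%g.
Proof.
move=> Aix Ajx.
have agree1 : f 1%g = g 1%g by rewrite (morph_one fM) (morph_one gM).
have agreeX : A true x -> A false x -> f (crossing x) = g (crossing x).
  move=> At Af; have [->//|n1] := pselect (crossing x = 1%g).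
  by apply: fg; split => //; exists x.
case: i j Aix Ajx => [] [] Aix Ajx; rewrite ?divgg //; first exact: agreeX.
have -> : (frm false x / frm true x = 1 / crossing x)%g by rewrite div1g invgF.
by rewrite (morph_div fM) (morph_div gM) agree1 agreeX.
Qed.

(** The class of a piece of the loop, corrected by the frames at its ends, lies where
    the two morphisms agree. This holds for short pieces because a piece inside
    [A l] has class [(frm l _)^-1 * frm l _], and it is stable under
    concatenation, whatever frames are used at the ends. *)
Lemma agree_on_basis : f =1 g.
Proof.
elim/quotW=> p; have cp := continuous_extend (@cts_fun _ _ p).
have ind a b : a <= b -> forall i j,
    A i (extend p a) -> A j (extend p b) ->
    let h := (frm i (extend p a) * path_class spoke (segment cp a b) /
              frm j (extend p b))%g in f h = g h.
  move: a b; apply: interval_induction.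
    move=> a m b _ _ am mb i j pi pj /=.
    have [l /nbhs_singleton pl] := cover (extend p m).
    rewrite -(path_class_homotopic _ (homotopic_segment cp a m b)).
    rewrite path_class_cat.
    have split (u v w t k : G) : (u * (v * w) / k = u * v / t * (t * w / k))%g.
      by rewrite !mulgA mulgVK.
    rewrite (split _ _ _ (frm l (extend p m))) fM gM.
    by congr mul; [exact: am|exact: mb].
  move=> r; have [U Ur [l Ul]] := cover_near cover r cp.
  exists U => // a b ab abU i j pi pj /=.
  have pl : runs_in (A l) (extend p) a b.
    by move=> s sab; apply/Ul/abU; rewrite /= in_itv.
  have pla : A l (extend p a) by apply: pl; rewrite lexx.
  have plb : A l (extend p b) by apply: pl; rewrite lexx andbT.
  have pab := range_segment (cp := cp) ab pl.
  have -> : path_class spoke (segment cp a b) =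
      ((frm l (extend p a))^-1 * frm l (extend p b))%g.
    by rewrite (frame_path spoke X_connected cover nullA Ax0 pab) mulKg.
  have split (u v w k : G) : (u * (w^-1 * v) / k = u / w * (v / k))%g.
    by rewrite !mulgA.
  by rewrite split fM gM; congr mul; exact: agree_frames.
have p01 : path_class spoke (segment cp 0 1) = \pi_(fundamental_group R x0) p.
  rewrite -(path_class_loop spoke0); apply: path_class_eq => t.
  rewrite /segment /= /mk_path /extend /affine_segment.
  by rewrite subr0 mul1r addr0 clampK.
(* The correction disappears at [x0], where the frame is [1]. *)
have := ind 0 1 ler01 true true.
rewrite p01 extend0 extend1 path_zero path_one => /(_ Ax0 Ax0).
by rewrite /= (frame_base spoke nullA Ax0) mul1g divg1.
Qed.
End agreement.

Section extension.
Context {H : groupType} (f : nerve_basis -> H).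

Definition basis_value (a : G) : H :=
  if pselect (nerve_basis a) is left aS then f (SigSub (mem_set aS)) else 1%g.

(** The covering with transition function [basis_value \o crossing]: only the quotient
    of the two frames matters, so the first one is taken to be [1]. *)
Definition glued_frame (j : bool) x : H :=
  if j then 1%g else (basis_value (crossing x))^-1%g.

Lemma glued_frame_compatible : @compatible_frames R X bool A H glued_frame.
Proof.
move=> i j p a b cp ab pi pj.
have [<-|ij] := eqVneq i j; first by rewrite !divgg.
have Cab : crossing (p a) = crossing (p b).
  by case: i j ij pi pj => [] [] // _ pi pj;
    apply: (crossing_invariant (p := segment cp a b)); apply: range_segment.
by case: i j {ij pi pj} => [] [] /=; rewrite ?Cab.
Qed.

Definition monodromy (a : G) : H := holonomy A glued_frame (repr a).

Lemma monodromyE (p : x0 ~> x0) :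
  monodromy (\pi_(fundamental_group R x0) p) = holonomy A glued_frame p.
Proof.
apply: (holonomy_homotopic cover glued_frame_compatible); try exact: cts_fun.
exact: repr_loopP.
Qed.

Lemma monodromyM : {morph monodromy : a b / (a * b)%g}.
Proof.
elim/quotW=> p; elim/quotW=> q; rewrite pi1_mulgE !monodromyE.
exact: (holonomy_cat cover glued_frame_compatible p q).
Qed.

Lemma monodromy_class x y (p : x ~> y) :
  monodromy (path_class spoke p) =
    (holonomy A glued_frame (spoke x) * holonomy A glued_frame p /
     holonomy A glued_frame (spoke y))%g.
Proof.
have gC := glued_frame_compatible.
by rewrite monodromyE !(holonomy_cat cover gC) (holonomy_inv cover gC) mulgA.
Qed.

(** Induction along the spanning tree. Inside a component both sides change by the
    same factor, the holonomy of a path there; at a door the crossing is [1], and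
    so is the transition function. *)
Lemma monodromy_frame j x : A j x ->
  monodromy (frm j x) = (glued_frame j x / holonomy A glued_frame (spoke x))%g.
Proof.
have gC := glued_frame_compatible.
move: j x; pose Z j x := monodromy (frm j x) =
  (glued_frame j x / holonomy A glued_frame (spoke x))%g.
apply: (@frame_ind _ _ _ _ spoke X_connected cover nullA Ax0 Z); rewrite /Z {Z}.
- rewrite (frame_base spoke nullA Ax0) (morph_one monodromyM) /=.
  rewrite (holonomy_homotopic cover gC _ _ spoke0); try exact: cts_fun.
  by rewrite (holonomy_id cover gC) divgg.
- move=> j x y [p pA] IHx.
  rewrite (frame_path spoke X_connected cover nullA Ax0 pA) monodromyM IHx.
  rewrite monodromy_class (holonomy_frames (p := p) cover gC _ pA); last exact: cts_fun.
  rewrite path_zero path_one !mulgA; congr (_ / _)%g.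
  by rewrite mulgVK mulgV mul1g.
- move=> j x At Af eqf; have c1 : crossing x = 1%g by rewrite /crossing eqf divgg.
  have bv1 : basis_value 1%g = 1%g.
    by rewrite /basis_value; case: pselect => // -[].
  have gl k : glued_frame k x = 1%g by case: k => //=; rewrite c1 bv1 invg1.
  by rewrite !gl; case: j => /=; rewrite eqf.
Qed.

(** By [monodromy_frame] the spokes cancel in the quotient of the two frames, which
    leaves the transition function. *)
Lemma monodromy_basis (s : nerve_basis) : monodromy (val s) = f s.
Proof.
have := set_mem (valP s); move=> sS; have [_ [x [At Af sx]]] := sS.
rewrite sx /crossing (morph_div monodromyM) !monodromy_frame // mulgKA /=.
rewrite invgK mul1g -sx /basis_value; case: pselect => // sS'.
by congr f; apply: val_inj.
Qed.
End extension.

Lemma nerve_basisP : is_basis nerve_basis.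
Proof.
move=> H f; exists (monodromy f); split.
  by split; [exact: monodromyM|exact: monodromy_basis].
move=> g [gM gf]; apply/funext; apply: agree_on_basis => //.
  exact: monodromyM.
move=> a aS; rewrite -[a]/(val (SigSub (mem_set aS) : nerve_basis)).
by rewrite gf monodromy_basis.
Qed.
End nerve_basis.

(** The root of the tree is the component of [x0] in the set labelled [true], hence
    the condition on [x0]. *)
Lemma free_of_cover (R : realType) (X : topologicalType) (x0 : X)
    (A : bool -> set X) :
  path_connected R [set: X] -> (forall x : X, exists j, nbhs x (A j)) ->
  (forall j, pi1_trivial_components R (A j)) -> A true x0 ->
  is_free_group (fundamental_group R x0).
Proof.
move=> Xc cover nullA Ax0; have [spoke spoke0] := spokes_exist x0 Xc.
by exists (nerve_basis A spoke); exact: nerve_basisP.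
Qed.

Theorem corollary3p8 (R : realType) (X : topologicalType) (x0 : X)
    (X1 X2 : set X)
    (hX : path_connected R [set: X])
    (hcover : interior X1 `|` interior X2 = [set: X])
    (h1 : pi1_trivial_components R X1)
    (h2 : pi1_trivial_components R X2) :
  is_free_group (fundamental_group R x0).
Proof.
have cov (x : X) : nbhs x X1 \/ nbhs x X2.
  by have : [set: X] x by []; rewrite -hcover.
(* The two sets are labelled so that [x0] lies in the first one. *)
have [/nbhs_singleton x01|/nbhs_singleton x02] := cov x0.
- apply: (@free_of_cover R X x0 (fun j => if j then X1 else X2)) => //.
    by move=> x; case: (cov x); [exists true|exists false].
  by case.
- apply: (@free_of_cover R X x0 (fun j => if j then X2 else X1)) => //.
    by move=> x; case: (cov x); [exists false|exists true].
  by case.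
Qed.
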